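(* Let $\{d_n\}_{n=0}^\infty$ be a sequence of integers with $0\le d_n\le n$ for all $n$, and for $n\ge 1$ let $a_n=\min\left\{\frac{d_n}{n},\frac{n-d_n}{n}\right\}$. (i) If $\sum_{n=1}^\infty a_n^k$ diverges for all positive integers $k$, then the random graph process with sequence $\{d_n\}$ almost surely generates the Rado graph. (ii) If there is a positive integer $k$ for which $\sum_{n=1}^\infty a_n^k$ converges, then the process almost surely does not generate the Rado graph.
   Context: Random graph process with sequence $\{d_n\}$: the vertex set is $\{v_0,v_1,v_2,\ldots\}$. In round $i=0,1,2,\ldots$, independently of the other rounds, a subset $A\subseteq\{v_0,\ldots,v_{i-1}\}$ of cardinality $d_i$ is chosen uniformly at random among all subsets of that cardinality, and $v_i$ is joined by an edge to every vertex of $A$. The result is a random graph on countably many vertices. The Rado graph is the (unique up to isomorphism) countably infinite graph such that for all disjoint finite sets $A,B$ of vertices there are infinitely many vertices adjacent to every element of $A$ and to no element of $B$. ''Generates the Rado graph'' means that the generated graph is isomorphic to it. *)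

(* Defs.v *)
From mathcomp Require Import all_boot all_order all_algebra.
From mathcomp Require Import all_classical all_reals all_analysis.
Import Order.TTheory GRing.Theory Num.Theory.
Import numFieldNormedType.Exports.
Set Implicit Arguments.
Unset Strict Implicit.
Unset Printing Implicit Defensive.
Local Open Scope classical_set_scope.
Local Open Scope ring_scope.

Record graph (V : Type) := Graph {
  adj : V -> V -> Prop ;
  adj_sym : forall x y, adj x y -> adj y x ;
  adj_irr : forall x, ~ adj x x }.

Definition isomorphic (V W : Type) (G : graph V) (H : graph W) : Prop :=
  exists2 f : V -> W, bijective f & forall x y, adj G x y <-> adj H (f x) (f y).

Definition is_rado (V : Type) (G : graph V) : Prop :=
  ([set: V] #= [set: nat])%card /\
  forall A B : set V, finite_set A -> finite_set B -> A `&` B = set0 ->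
    infinite_set [set v | (forall a, A a -> adj G v a) /\
                          (forall b, B b -> ~ adj G v b)].

Section Process.
Context {R : realType} {disp : measure_display} {Omega : measurableType disp}.
Implicit Types (P : probability Omega R) (d : nat -> nat).

(* The vertex v_i is encoded as i : nat, so that {v_0, ..., v_(i-1)} is 'I_i;
   A i is the random set of earlier vertices to which v_i is joined. *)
Implicit Type A : forall i : nat, Omega -> {set 'I_i}.

Definition uniform_subset P (i k : nat) (X : Omega -> {set 'I_i}) : Prop :=
  forall S : {set 'I_i},
    P [set w | X w = S] = (if #|S| == k then ('C(i, k)%:R)^-1 else 0)%:E.

Definition mutually_independent P A : Prop :=
  forall (J : seq nat) (B : forall i : nat, {set {set 'I_i}}), uniq J ->
    P [set w | forall i, i \in J -> A i w \in B i] =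
    (\prod_(i <- J) P [set w | A i w \in B i])%E.

Definition graph_process P d A : Prop :=
  [/\ forall i (S : {set 'I_i}), measurable [set w | A i w = S],
      forall i, uniform_subset P (d i) (A i)
    & mutually_independent P A].

Definition chosen A (w : Omega) (i j : nat) : Prop :=
  exists2 k : 'I_i, k \in A i w & j = k.

Definition generated_adj A (w : Omega) (i j : nat) : Prop :=
  chosen A w i j \/ chosen A w j i.

Lemma generated_adj_sym A w i j :
  generated_adj A w i j -> generated_adj A w j i.
Proof. by case; [right|left]. Qed.

Lemma generated_adj_irr A w i : ~ generated_adj A w i i.
Proof. by case=> -[k _ ik]; have := ltn_ord k; rewrite -ik ltnn. Qed.

Definition generated A (w : Omega) : graph nat :=
  Graph (@generated_adj_sym A w) (@generated_adj_irr A w).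

End Process.

Definition min_ratio (R : realType) (d : nat -> nat) (n : nat) : R :=
  Num.min ((d n)%:R / n%:R) ((n%:R - (d n)%:R) / n%:R).

(* A graph satisfying is_rado: m ~ n when one of them occurs in the finite
   sequence coded by the other. *)
Definition code_adj (m n : nat) : Prop :=
  m <> n /\ ((m \in CodeSeq.decode n) || (n \in CodeSeq.decode m)).

Lemma code_adj_sym m n : code_adj m n -> code_adj n m.
Proof. by case=> mn h; split; [exact/nesym | rewrite orbC]. Qed.

Lemma code_adj_irr n : ~ code_adj n n.
Proof. by case. Qed.

Definition code_graph : graph nat := Graph code_adj_sym code_adj_irr.

Lemma code_graph_rado : is_rado code_graph.
Proof.
split; first exact: card_eqxx.
move=> _ _ /finite_seqP[a ->] /finite_seqP[b ->] ab0.
pose N := (\max_(i <- b) i).+1.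
have Nb : N \notin b.
  apply/negP => Nb; have := @leq_bigmax_seq _ _ xpredT id _ Nb isT.
  by rewrite /N ltnn.
pose f m := CodeSeq.code (a ++ nseq m N).
have finj : injective f.
  move=> m m' /(congr1 CodeSeq.decode); rewrite !CodeSeq.codeK.
  by move=> /(congr1 size); rewrite !size_cat !size_nseq => /addnI.
pose bad := a ++ b ++ flatten [seq CodeSeq.decode x | x <- b].
have finf : infinite_set (range f).
  have /card_eqPle[_ h] : (range f #= [set: nat])%card.
    by apply: inj_card_eq => x y _ _; exact: finj.
  exact/infiniteP.
apply: (@sub_infinite_set _ (range f `\` [set` bad])); last first.
  by apply: infinite_setD => //; exact: finite_seq.
move=> _ [[m _ <-] /negP].
rewrite /= /bad !mem_cat !negb_or => /and3P[fa fb fd].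
split=> x /= xs; rewrite /code_adj /= /f CodeSeq.codeK.
  by split; [move=> E; move: fa; rewrite /f E xs | rewrite mem_cat xs orbT].
case=> _ /orP[h|].
  by case/negP: fd; apply/flattenP; exists (CodeSeq.decode x) => //; exact: map_f.
rewrite mem_cat => /orP[xa|].
  by have : ([set` a] `&` [set` b]) x by []; rewrite ab0.
by rewrite mem_nseq => /andP[_ /eqP xN]; case/negP: Nb; rewrite -xN.
Qed.

(* Main.v *)
Require Import Defs.
From mathcomp Require Import all_boot all_order all_algebra.
From mathcomp Require Import all_classical all_reals all_analysis.
From mathcomp Require Import zify ring lra.
Import Order.TTheory GRing.Theory Num.Theory.
Import numFieldNormedType.Exports.
Set Implicit Arguments.
Unset Strict Implicit.
Unset Printing Implicit Defensive.

(** Fix disjoint finite sets of vertices a and b, with s and t elements.  Once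
round n is beyond all of them, v_n is joined to all of a and to nothing in b
with probability
  p_n = d_n^_s * (n - d_n)^_t / n^_(s + t)
(falling factorials), as one sees by counting the d_n-subsets that contain a
and miss b ([card_separating], [witness_prob]).  Everything rests on comparing
p_n with powers of a_n = min (d_n, n - d_n) / n.

Divergence.  When min (d_n, n - d_n) >= 2 (s + t), each factor of a falling
factorial in the numerator is at least half of d_n or of n - d_n, so that p_n
is at least (a_n / 2)^(s + t).  Otherwise a_n < 2 (s + t) / n, and then any
power of a_n with exponent at least 2 is below a constant times 1 / n^2.  Both
cases are covered at once by the exponent s + t + 2 ([min_ratio_le]), so the
divergence of the series of a_n^(s + t + 2) forces that of the series of p_n.
The rounds are independent, hence by the second Borel-Cantelli lemma
([choice_BorelCantelli]) some v_n beyond any prescribed index is almost surely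
such a vertex ([ae_witness]).  There are countably many pairs (a, b), so almost
surely this holds for all of them together: the graph satisfies the extension
property of the Rado graph ([ae_rado]), and back-and-forth gives the
isomorphism ([rado_unique]).

Convergence.  If the series of a_n^k converges, take s = t = k.  The product
of the two ratios d_n / n and (n - d_n) / n is at most their minimum, so that
p_n <= 4^k a_n^k for n >= 4 k ([sep_prob_le]) and the series of p_n converges.
By the first Borel-Cantelli lemma, almost surely only finitely many vertices
are joined to all of v_0, ..., v_(k-1) and to none of v_k, ..., v_(2k-1): the
extension property fails for this one pair ([ae_not_rado]).  As it is
invariant under isomorphism ([rado_iso]), the graph is not the Rado graph. *)

(** * Counting the subsets that contain one set and avoid another *)

Definition separating {T : finType} (E F : {set T}) : {set {set T}} :=
  [set S : {set T} | (E \subset S) && [disjoint S & F]].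

Lemma bin_ffact_sub (n k s t : nat) :
  (s <= k)%N -> (s + t <= n)%N -> (k <= n)%N ->
  ('C(n - s - t, k - s) * n ^_ (s + t) = 'C(n, k) * (k ^_ s * (n - k) ^_ t))%N.
Proof.
move=> sk stn kn.
have [tk|kt] := leqP t (n - k); last first.
  by rewrite bin_small ?(ffact_small kt) ?muln0 // ; lia.
(* With the factorials left out of the falling factorials of k and n - k put
   back, both sides are n!. *)
apply/eqP; rewrite -(@eqn_pmul2r ((k - s)`! * (n - k - t)`!)%N); last first.
  by rewrite muln_gt0 !fact_gt0.
have h1 := @bin_fact (n - s - t) (k - s) ltac:(lia).
have h2 := bin_fact kn.
have h3 := ffact_fact stn.
have h4 := ffact_fact sk.
have h5 := ffact_fact tk.
have e1 : (n - s - t - (k - s) = n - k - t)%N by lia.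
have e2 : (n - (s + t) = n - s - t)%N by lia.
rewrite e1 in h1; rewrite e2 in h3.
apply/eqP; transitivity (n`!)%N.
  by rewrite -h3 -h1; ring.
by rewrite -h2 -h4 -h5; ring.
Qed.

(** Such a set S is E together with a subset of the complement of E and F of
cardinality k - #|E|.  The count is stated through falling factorials, without
division, so that it also covers the degenerate cases k < #|E| and
#|T| - k < #|F|, in which both sides vanish. *)
Lemma card_separating (T : finType) (E F : {set T}) (k : nat) :
  [disjoint E & F] -> (k <= #|T|)%N ->
  (#|[set S in separating E F | #|S| == k]| * #|T| ^_ (#|E| + #|F|)
   = 'C(#|T|, k) * (k ^_ #|E| * (#|T| - k) ^_ #|F|))%N.
Proof.
move=> EF kT.
have cEF : (#|E :|: F| = #|E| + #|F|)%N.
  by rewrite cardsU; move/disjoint_setI0: EF => ->; rewrite cards0 subn0.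
have [sk|ks] := leqP #|E| k; last first.
  rewrite (ffact_small ks) mul0n muln0.
  rewrite (_ : [set S in _ | _] = finset.set0) ?cards0 ?mul0n //.
  apply/finset.setP => S; rewrite !inE; apply/negP => /andP[/andP[ES _] /eqP Sk].
  by have := subset_leq_card ES; rewrite Sk leqNgt ks.
have stn : (#|E| + #|F| <= #|T|)%N by rewrite -cEF max_card.
rewrite -bin_ffact_sub //; congr (_ * _)%N.
have -> : (#|T| - #|E| - #|F| = #|~: (E :|: F)|)%N.
  by rewrite -[LHS]subnDA -cEF -cardsT -cardsDS ?finset.subsetT // finset.setTD.
(* The bijection is U |-> E :|: U, with inverse S |-> S :\: E. *)
rewrite -cards_draws -(@card_in_imset _ _ (fun U => E :|: U)%SET); last first.
  move=> U U'; rewrite !inE => /andP[UEF _] /andP[UEF' _].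
  move=> /(congr1 (fun X => X :\: E)%SET).
  have h (W : {set T}) : W \subset ~: (E :|: F) -> (((E :|: W) :\: E) = W)%SET.
    move=> WEF; apply/finset.setP => x; rewrite !inE.
    have := fintype.subsetP WEF x; rewrite !inE.
    by case: (x \in E); case: (x \in W) => //= /(_ isT).
  by rewrite !h.
congr #|pred_of_set _|; apply/finset.setP => S.
apply/idP/imsetP => [|[U]]; rewrite !inE.
  move=> /andP[/andP[ES SF] /eqP Sk]; exists (S :\: E)%SET.
    rewrite !inE cardsDS // Sk eqxx andbT.
    apply/fintype.subsetP => x; rewrite !inE negb_or => /andP[-> xS] /=.
    by rewrite (disjointFr SF xS).
  apply/finset.setP => x; rewrite !inE; have := fintype.subsetP ES x.
  by case: (x \in E); case: (x \in S) => //= /(_ isT).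
move=> /andP[UEF /eqP Uk] ->; rewrite finset.subsetUl /=.
have EU : [disjoint E & U].
  rewrite disjoint_sym finset.disjoints_subset (fintype.subset_trans UEF) //.
  by rewrite finset.setCS finset.subsetUl.
rewrite cardsU (disjoint_setI0 EU) cards0 subn0 Uk subnKC // eqxx andbT.
rewrite finset.disjoints_subset finset.subUset -finset.disjoints_subset EF /=.
by rewrite (fintype.subset_trans UEF) // finset.setCS finset.subsetUr.
Qed.

Local Open Scope classical_set_scope.
Local Open Scope ring_scope.

(** * Uniqueness of the Rado graph, by back-and-forth *)

(** Partial isomorphisms are taken as sets of pairs, so that the back step is
the forth step for the flipped set and a limit of partial isomorphisms is a union;
the equivalence of the two equalities makes the set the graph of a partial
injection. *)
Definition partial_iso (V W : Type) (G : graph V) (H : graph W)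
    (p : set (V * W)) : Prop :=
  forall x y, p x -> p y ->
    (x.1 = y.1 <-> x.2 = y.2) /\ (adj G x.1 y.1 <-> adj H x.2 y.2).

Definition flip (V W : Type) (p : set (V * W)) : set (W * V) :=
  [set x | p (x.2, x.1)].

Lemma partial_iso_flip (V W : Type) (G : graph V) (H : graph W)
    (p : set (V * W)) :
  partial_iso G H p -> partial_iso H G (flip p).
Proof. by move=> ip x y /ip{}ip /ip /= [? ?]; split; apply: iff_sym. Qed.

Lemma finite_flip (V W : Type) (p : set (V * W)) :
  finite_set p -> finite_set (flip p).
Proof.
move=> /(finite_image (fun x => (x.2, x.1))).
apply: sub_finite_set => -[w v] /= pvw.
by exists (v, w).
Qed.

(** The image of v is a vertex joined to the images of the neighbours of v, to
no image of a non-neighbour, and distinct from all vertices already used: it is to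
ensure the last point that the extension property asks for infinitely many
vertices. *)
Lemma partial_iso_extend (V W : Type) (G : graph V) (H : graph W)
    (p : set (V * W)) (v : V) :
  is_rado H -> finite_set p -> partial_iso G H p ->
  exists w, partial_iso G H (p `|` [set (v, w)]).
Proof.
move=> [_ radoH] fp ip.
have [[w pvw]|vNp] := pselect (exists w, p (v, w)).
  by exists w => x y [px|->] [py|->]; apply: ip.
pose B := [set x.2 | x in p `&` [set x | adj G v x.1]].
pose C := [set x.2 | x in p `&` [set x | ~ adj G v x.1]].
have fB : finite_set B by apply/finite_image/(sub_finite_set _ fp) => x [].
have fC : finite_set C by apply/finite_image/(sub_finite_set _ fp) => x [].
have BC0 : B `&` C = set0.
  rewrite -subset0 => _ [[x [px ax] <-] [y [py ay] yx]]; apply: ay.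
  by have [/iffRL/(_ yx) -> _] := ip y x py px.
have /infinite_setD/(_ (finite_image snd fp))/infinite_setN0[w [[wB wC] wNp]] :=
  radoH B C fB fC BC0.
have hv x : p x -> (x.1 = v <-> x.2 = w) /\ (adj G x.1 v <-> adj H x.2 w).
  move=> px; split; split.
  - by move=> xv; case: vNp; exists x.2; rewrite -xv -surjective_pairing.
  - by move=> xw; case: wNp; exists x.
  - by move=> xv; apply/adj_sym/wB; exists x => //; split => //; apply: adj_sym.
  - move=> xw; apply: adj_sym; apply: contrapT => vx.
    by apply: (wC x.2); [exists x | apply: adj_sym].
exists w => x y [px|->] [py|->] /=.
- exact: ip.
- exact: hv.
- have [[h1 h2] [h3 h4]] := hv y py; split; split.
  + by move=> e; apply: esym; apply: h1; exact: esym.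
  + by move=> e; apply: esym; apply: h2; exact: esym.
  + by move=> a; apply: adj_sym; apply: h3; exact: adj_sym.
  + by move=> a; apply: adj_sym; apply: h4; exact: adj_sym.
- by split=> //; split => [/(@adj_irr _ G)|/(@adj_irr _ H)].
Qed.

Lemma partial_iso_extend2 (V W : Type) (G : graph V) (H : graph W)
    (p : set (V * W)) (v : V) (w : W) :
  is_rado G -> is_rado H -> finite_set p -> partial_iso G H p ->
  exists q, [/\ p `<=` q, finite_set q, partial_iso G H q,
    exists w', q (v, w') & exists v', q (v', w)].
Proof.
move=> rG rH fp ip.
have [w' ip'] := partial_iso_extend v rH fp ip.
have fp' : finite_set (p `|` [set (v, w')]) by rewrite finite_setU; split.
have [v' iq] :=
  partial_iso_extend w rG (finite_flip fp') (partial_iso_flip ip').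
exists (flip (flip (p `|` [set (v, w')]) `|` [set (w, v')])); split.
- by move=> [x y] pxy; left; left.
- by apply: finite_flip; rewrite finite_setU; split => //; apply: finite_flip.
- exact: partial_iso_flip.
- by exists w'; left; right.
- by exists v'; right.
Qed.

Lemma rado_enum (V : Type) (G : graph V) :
  is_rado G -> exists e : nat -> V, forall v, exists n, e n = v.
Proof.
move=> [/card_set_bijP[f fbij] _].
move: fbij; rewrite setTT_bijective => -[e fK eK].
by exists e => v; exists (f v).
Qed.

(** An increasing sequence of finite partial isomorphisms, the n-th of which
treats the n-th vertex on either side, has as union a total bijective one. *)
Lemma rado_unique (V W : Type) (G : graph V) (H : graph W) :
  is_rado G -> is_rado H -> isomorphic G H.
Proof.
move=> rG rH.
have [eV eVs] := rado_enum rG; have [eW eWs] := rado_enum rH.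
pose st := {p : set (V * W) | finite_set p /\ partial_iso G H p}.
have p0 : st by exists set0; split => // x y [].
have next (x : st * nat) : exists q : st,
    [/\ sval x.1 `<=` sval q, exists w, sval q (eV x.2, w)
      & exists v, sval q (v, eW x.2)].
  case: x => -[p [fp ip]] n.
  have [q [pq fq iq h1 h2]] := partial_iso_extend2 (eV n) (eW n) rG rH fp ip.
  by exists (exist _ q (conj fq iq)).
have [nx nxP] := choice next.
pose F := fix F n : st := if n is m.+1 then nx (F m, m) else p0.
have Fmono m n : (m <= n)%N -> sval (F m) `<=` sval (F n).
  elim: n => [|n IHn]; first by rewrite leqn0 => /eqP ->.
  rewrite leq_eqVlt => /predU1P[-> //|/IHn mn].
  by apply: (subset_trans mn); have [] := nxP (F n, n).
pose r := [set x | exists n, sval (F n) x].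
have ir : partial_iso G H r.
  move=> x y [m mx] [n ny].
  have [_ ip] := svalP (F (maxn m n)).
  apply: ip; first by apply: Fmono mx; rewrite leq_maxl.
  by apply: Fmono ny; rewrite leq_maxr.
have rV v : exists w, r (v, w).
  have [n <-] := eVs v; have [_ [w vw] _] := nxP (F n, n).
  by exists w, n.+1.
have rW w : exists v, r (v, w).
  have [n <-] := eWs w; have [_ _ [v vw]] := nxP (F n, n).
  by exists v, n.+1.
have [f fP] := choice rV; have [g gP] := choice rW.
exists f; last by move=> x y; have [] := ir _ _ (fP x) (fP y).
exists g => [v|w].
- by have [/iffRL/(_ erefl)] := ir _ _ (gP (f v)) (fP v).
- by have [/iffLR/(_ erefl)] := ir _ _ (fP (g w)) (gP w).
Qed.

Lemma rado_iso (V W : Type) (G : graph V) (H : graph W) :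
  isomorphic G H -> is_rado H -> is_rado G.
Proof.
move=> [f fbij fadj] [/card_set_bijP[e ebij] radoH].
split.
  apply/card_set_bijP; exists (e \o f).
  move: ebij; rewrite !setTT_bijective => ebij.
  exact: bij_comp.
move=> B C fB fC BC0.
have fBC0 : (f @` B) `&` (f @` C) = set0.
  rewrite -subset0 => _ [[x Bx <-] [y Cy /(bij_inj fbij) yx]].
  by have : (B `&` C) x; [split => //; rewrite -yx | rewrite BC0].
have := radoH _ _ (finite_image f fB) (finite_image f fC) fBC0.
apply: contra_not => /(finite_image f); apply: sub_finite_set => w [wB wC].
have [g _ gK] := fbij; exists (g w) => //; split => x xX.
  by apply/fadj; rewrite gK; apply: wB; exists x.
by move=> /fadj; rewrite gK; apply: wC; exists x.
Qed.


(** * The law of the rounds and the second Borel-Cantelli lemma *)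

Section Law.
Context {R : realType} {disp : measure_display} {Omega : measurableType disp}.
Context {P : probability Omega R} {d : nat -> nat}.
Context {A : forall i : nat, Omega -> {set 'I_i}}.
Hypothesis procA : graph_process P d A.

Let choice_bigcup n (S : {set {set 'I_n}}) :
  [set w | A n w \in S] = \bigcup_(T in [set` enum S]) [set w | A n w = T].
Proof.
apply/seteqP; split => w /=.
  by move=> AS; exists (A n w) => //=; rewrite mem_enum.
by move=> [T /=]; rewrite mem_enum => TS ->.
Qed.

Lemma choice_measurable n (S : {set {set 'I_n}}) :
  measurable [set w | A n w \in S].
Proof.
rewrite choice_bigcup; apply: fin_bigcup_measurable; first exact: finite_seq.
by move=> T _; have [+ _ _] := procA.
Qed.

Lemma choice_law n (S : {set {set 'I_n}}) :
  P [set w | A n w \in S] =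
  (#|[set T in S | #|T| == d n]%SET|%:R / 'C(n, d n)%:R)%:E.
Proof.
have [mA lawA _] := procA.
rewrite choice_bigcup measure_fin_bigcup; first last.
- by move=> T _; exact: mA.
- by move=> T U _ _ [w []] /= <- <-.
- exact: finite_seq.
rewrite -fsbig_seq ?enum_uniq //=.
under eq_bigr do rewrite lawA.
rewrite sumEFin; congr _%:E.
rewrite -big_mkcond /= big_const_seq iter_addr_0 [RHS]mulr_natl.
congr (_ *+ _).
rewrite cardE -size_filter; apply/perm_size/uniq_perm => [||T].
- by apply: filter_uniq; exact: enum_uniq.
- exact: enum_uniq.
- by rewrite mem_filter !mem_enum !inE andbC.
Qed.

(** The second Borel-Cantelli lemma.  By independence the event is missed in the
rounds from N0 to N - 1 with probability the product of the 1 - p_n, which is at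
most 1 / (1 + p_N0 + ... + p_(N-1)) because (1 - p) (1 + x + p) <= 1 + x. *)
Lemma choice_BorelCantelli (B : forall i : nat, {set {set 'I_i}})
    (p : nat -> R) (N0 : nat) :
  (forall n, (N0 <= n)%N -> P [set w | A n w \in B n] = (p n)%:E) ->
  (forall M : R, exists N, M <= \sum_(N0 <= n < N) p n) ->
  {ae P, forall w, exists2 n, (N0 <= n)%N & A n w \in B n}.
Proof.
move=> pP psum.
have p_ge0 n : (N0 <= n)%N -> 0 <= p n.
  by move=> /pP pn; rewrite -lee_fin -pn.
have p_le1 n : (N0 <= n)%N -> p n <= 1.
  move=> /pP pn; rewrite -lee_fin -pn probability_le1 //.
  exact: choice_measurable.
pose miss N :=
  [set w | forall i, i \in index_iota N0 N -> A i w \in (~: B i)%SET].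
have missP N : P (miss N) = (\prod_(N0 <= n < N) (1 - p n))%:E.
  have [_ _ indA] := procA.
  rewrite indA ?iota_uniq // -prodEFin !big_seq; apply: eq_bigr => i.
  rewrite mem_index_iota => /andP[Ni _].
  rewrite (_ : [set w | _] = ~` [set w | A i w \in B i]); last first.
    by apply/seteqP; split => w /=; rewrite inE => /negP.
  rewrite probability_setC ?pP //; exact: choice_measurable.
have prod_le N :
    (\prod_(N0 <= n < N) (1 - p n)) * (1 + \sum_(N0 <= n < N) p n) <= 1.
  elim: N => [|N IHN]; first by rewrite !big_geq // mul1r addr0.
  have [NN|NN] := leqP N0 N; last by rewrite !big_geq // mul1r addr0.
  rewrite !big_nat_recr //=; apply: le_trans IHN.
  rewrite -mulrA; apply: ler_wpM2l.
    rewrite big_nat_cond; apply: prodr_ge0 => i /andP[/andP[Ni _] _].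
    by rewrite subr_ge0 p_le1.
  have sum_ge0 : 0 <= \sum_(N0 <= n < N) p n.
    rewrite big_nat_cond; apply: sumr_ge0 => i /andP[/andP[Ni _] _].
    exact: p_ge0.
  by have := p_ge0 N NN; nra.
pose Z := \bigcap_(n in [set n | (N0 <= n)%N])
  [set w | A n w \in (~: B n)%SET].
have mZ : measurable Z.
  apply: bigcap_measurable; first by exists N0 => /=.
  by move=> n _; exact: choice_measurable.
exists Z; split => //; last first.
  move=> w /= nw n /= Nn; rewrite inE; apply/negP => An.
  by apply: nw; exists n.
have PZ0 : (0 <= fine (P Z)) by exact: fine_ge0.
rewrite -(@fineK _ (P Z)) ?fin_num_measure //; congr _%:E.
(* A positive P Z would be contradicted by a partial sum above 1 / P Z. *)
apply/eqP; rewrite eq_le PZ0 andbT leNgt; apply/negP => PZ.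
have [N hN] := psum ((fine (P Z))^-1).
have : fine (P Z) <= \prod_(N0 <= n < N) (1 - p n).
  rewrite -lee_fin -missP fineK ?fin_num_measure //.
  apply: le_measure; rewrite ?inE //.
    rewrite (_ : miss N = \bigcap_(i in [set` index_iota N0 N])
        [set w | A i w \in (~: B i)%SET]) //.
    by apply: fin_bigcap_measurable => // i _; exact: choice_measurable.
  by move=> w Zw i; rewrite mem_index_iota => /andP[Ni _]; exact: Zw.
have := prod_le N; move: hN PZ.
set x := fine _; set y := \prod_(_ <= _ < _) _; set z := \sum_(_ <= _ < _) _.
move=> xz x0 yz1 xy.
have : 1 <= x * z by rewrite -(mulfV (lt0r_neq0 x0)) ler_pM2l.
have z0 : 0 < z by apply: lt_le_trans xz; rewrite invr_gt0.
have : x * z <= y * z by rewrite ler_pM2r.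
nra.
Qed.

End Law.

(** * Comparing falling factorials with powers of the minimal ratio *)

Lemma ffact_leX n m : (n ^_ m <= n ^ m)%N.
Proof.
elim: m n => [|m IHm] n; first by rewrite ffactn0.
rewrite ffactnS expnS leq_mul2l; apply/orP; right.
apply: leq_trans (IHm _) _.
by case: m {IHm} => [//|m]; rewrite leq_exp2r // leq_pred.
Qed.

Lemma leX_ffact n m : (m.*2 <= n)%N -> (n ^ m <= 2 ^ m * n ^_ m)%N.
Proof.
move=> mn.
suff h k : (k <= m)%N -> (n ^ k <= 2 ^ k * n ^_ k)%N by exact: h.
elim: k => [|k IHk] km; first by rewrite ffactn0.
rewrite expnSr ffactnSr expnSr mulnACA.
by apply: leq_mul; [apply: IHk; exact: ltnW | lia].
Qed.

(** The probability that a uniform [k]-subset of an [n]-set contains [s] given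
elements and avoids [t] others. *)
Definition sep_prob {R : realType} (s t n k : nat) : R :=
  (k ^_ s * (n - k) ^_ t)%:R / (n ^_ (s + t))%:R.

Lemma min_ratioE (R : realType) (d : nat -> nat) n : (d n <= n)%N ->
  min_ratio R d n = (minn (d n) (n - d n))%:R / n%:R.
Proof.
move=> dn; rewrite /min_ratio -natrB //.
have inv0 : (0 : R) <= n%:R^-1 by rewrite invr_ge0.
have [le|lt] := leqP (d n) (n - d n).
  by rewrite min_l // ler_wpM2r // ler_nat.
by rewrite min_r // ler_wpM2r // ler_nat ltnW.
Qed.

Lemma min_ratio_ge0 (R : realType) (d : nat -> nat) n : (d n <= n)%N ->
  0 <= min_ratio R d n.
Proof. by move=> dn; rewrite min_ratioE // divr_ge0. Qed.

(** In the numerator d_n (n - d_n) <= n min (d_n, n - d_n); in the denominator,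
n >= 4 k makes each of the 2 k factors of n^_(2 k) at least n / 2, whence the
constant 4^k. *)
Lemma sep_prob_le (R : realType) (d : nat -> nat) (k n : nat) :
  (d n <= n)%N -> (k.*2.*2 <= n)%N ->
  sep_prob k k n (d n) <= 4 ^+ k * min_ratio R d n ^+ k.
Proof.
move=> dn; have [->|k0] := posnP k.
  by move=> _; rewrite /sep_prob !ffactn0 divr1 !expr0 mulr1.
move=> kn; have n0 : (0 < n)%N by lia.
have nat_le : (d n ^_ k * (n - d n) ^_ k * n ^ k <=
    4 ^ k * minn (d n) (n - d n) ^ k * n ^_ (k + k))%N.
  have h1 : (d n ^_ k * (n - d n) ^_ k <= minn (d n) (n - d n) ^ k * n ^ k)%N.
    apply: (leq_trans (leq_mul (ffact_leX _ _) (ffact_leX _ _))).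
    by rewrite -!expnMn leq_exp2r //; nia.
  have h2 : (n ^ (k + k) <= 2 ^ (k + k) * n ^_ (k + k))%N.
    by apply: leX_ffact; rewrite addnn.
  have -> : (4 ^ k = 2 ^ (k + k))%N by rewrite addnn -mul2n expnM.
  apply: (@leq_trans (minn (d n) (n - d n) ^ k * n ^ k * n ^ k)).
    by rewrite leq_mul2r h1 orbT.
  rewrite -mulnA -expnD; apply: leq_trans (leq_mul (leqnn _) h2) _.
  by rewrite mulnA [(2 ^ _ * _)%N]mulnC.
rewrite min_ratioE // expr_div_n mulrA /sep_prob.
rewrite ler_pdivrMr ?ltr0n ?ffact_gt0; last lia.
rewrite mulrAC ler_pdivlMr ?exprn_gt0 ?ltr0n //.
by rewrite -!natrX -!natrM ler_nat.
Qed.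

(** If m = min (d_n, n - d_n) is at least 2 (s + t), the factors of the falling
factorials in the numerator of [sep_prob] are at least m / 2, and the first term
on the right suffices.  If not, a_n <= 2 (s + t) / n and the second term does:
the exponent exceeds s + t by two so that 1 / n^2 can be split off, which keeps
these rounds summable, even for s + t = 0. *)
Lemma min_ratio_le (R : realType) (d : nat -> nat) (s t n : nat) :
  (d n <= n)%N -> (0 < n)%N ->
  min_ratio R d n ^+ (s + t).+2 <=
  2 ^+ (s + t) * sep_prob s t n (d n) + (s + t).*2%:R ^+ (s + t).+2 / n%:R ^+ 2.
Proof.
move=> dn n0; rewrite min_ratioE //; set m := minn _ _.
have nR : (0 : R) < n%:R by rewrite ltr0n.
have mn : (m <= n)%N by rewrite /m; lia.
have x_le1 : (m%:R / n%:R : R) <= 1 by rewrite ler_pdivrMr // mul1r ler_nat.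
have x_ge0 : 0 <= (m%:R / n%:R : R) by rewrite divr_ge0.
have sep_ge0 : 0 <= sep_prob s t n (d n) :> R by rewrite divr_ge0.
have [stm|mst] := leqP (s + t).*2 m.
- apply: ler_wpDr; first by rewrite divr_ge0 // exprn_ge0.
  apply: (@le_trans _ _ ((m%:R / n%:R) ^+ (s + t))).
    by apply: ler_wiXn2l => //; rewrite -addn2 leq_addr.
  rewrite expr_div_n /sep_prob mulrA.
  rewrite ler_pdivrMr ?exprn_gt0 // mulrAC ler_pdivlMr ?ltr0n ?ffact_gt0; last lia.
  rewrite -!natrX -!natrM ler_nat.
  apply: (@leq_trans (d n ^ s * (n - d n) ^ t * n ^ (s + t))).
    apply: leq_mul; last exact: ffact_leX.
    rewrite expnD; apply: leq_mul.
      by case: (s) => [|s'] //; rewrite leq_exp2r // geq_minl.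
    by case: (t) => [|t'] //; rewrite leq_exp2r // geq_minr.
  rewrite leq_mul2r; apply/orP; right.
  rewrite expnD mulnACA; apply: leq_mul; apply: leX_ffact; rewrite /m in stm; lia.
- apply: ler_wpDl; first by rewrite mulr_ge0 // exprn_ge0.
  apply: (@le_trans _ _ (((s + t).*2%:R / n%:R) ^+ (s + t).+2)).
    apply: lerXn2r; rewrite ?nnegrE ?divr_ge0 //.
    by rewrite ler_pM2r ?invr_gt0 // ler_nat ltnW.
  rewrite expr_div_n ler_wpM2l ?exprn_ge0 // lef_pV2 ?posrE ?exprn_gt0 //.
  by apply: ler_weXn2l; rewrite ?ler1n.
Qed.

Lemma sum_invr_sqr_le (R : realType) N :
  \sum_(1 <= n < N) (n%:R ^+ 2)^-1 <= 2 :> R.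
Proof.
(* The stronger bound 2 - 1 / N on the sum of the first N terms is the one that
   induction preserves, since 1 / (N + 1)^2 <= 1 / N - 1 / (N + 1). *)
suff h : \sum_(1 <= n < N.+2) (n%:R ^+ 2)^-1 <= 2 - N.+1%:R^-1 :> R.
  have [N1|N1] := leqP N 1; first by rewrite big_geq.
  apply: (@le_trans _ _ (2 - N.+1%:R^-1)); last by rewrite gerBl invr_ge0.
  apply: le_trans h; rewrite !big_nat_recr //=; last exact: ltnW.
  by rewrite -addrA lerDl addr_ge0 // invr_ge0 exprn_ge0.
elim: N => [|N IHN]; first by rewrite big_nat1 expr1n invr1; lra.
rewrite big_nat_recr //=; apply: le_trans (lerD IHN (lexx _)) _.
have x0 : (0 : R) < N.+1%:R by rewrite ltr0n.
rewrite -[N.+2%:R]natr1; set x : R := N.+1%:R in x0 *.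
have -> : 2 - x^-1 + ((x + 1) ^+ 2)^-1 = 2 - (x + 1)^-1 - (x * (x + 1) ^+ 2)^-1.
  by field; rewrite !gt_eqF // addr_gt0.
by rewrite gerBl invr_ge0 mulr_ge0 ?exprn_ge0 // ?addr_ge0 // ltW.
Qed.

(** * Vertices joined to one finite set and to nothing in another *)

Definition witness (a b : seq nat) (n : nat) : {set {set 'I_n}} :=
  separating [set k : 'I_n | val k \in a]%SET [set k : 'I_n | val k \in b]%SET.

Lemma card_ord_mem n (a : seq nat) : uniq a -> all (fun i => (i < n)%N) a ->
  #|[set k : 'I_n | val k \in a]%SET| = size a.
Proof.
move=> ua /allP an.
rewrite cardE -(size_map val); apply/perm_size/uniq_perm => //.
  by rewrite map_inj_uniq ?enum_uniq //; exact: val_inj.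
move=> i; apply/mapP/idP => [[k]|ia].
  by rewrite mem_enum inE => ? ->.
by exists (Ordinal (an i ia)); rewrite ?mem_enum ?inE.
Qed.

Lemma witness_adj (disp : measure_display) (Omega : measurableType disp)
    (A : forall i : nat, Omega -> {set 'I_i})
    (a b : seq nat) (n : nat) (w : Omega) :
  all (fun i => (i < n)%N) a -> all (fun i => (i < n)%N) b ->
  A n w \in witness a b n <->
  (forall x, x \in a -> generated_adj A w n x) /\
  (forall x, x \in b -> ~ generated_adj A w n x).
Proof.
move=> /allP an /allP bn.
have adjE (k : 'I_n) : generated_adj A w n k <-> k \in A n w.
  split=> [[[j jA /val_inj->] //|[j _ nj]]|kA]; last by left; exists k.
  by have := ltn_ord j; rewrite -nj ltnNge ltnW.
rewrite /witness /separating inE; split.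
  move=> /andP[/fintype.subsetP aA Ab]; split => x xX.
    by apply/(adjE (Ordinal (an x xX)))/aA; rewrite inE.
  move=> /(adjE (Ordinal (bn x xX))); apply/negP.
  by rewrite (disjointFl Ab) // inE.
move=> [aA bA]; apply/andP; split.
  by apply/fintype.subsetP => k; rewrite inE => /aA/adjE.
rewrite disjoint_sym; apply/pred0P => k /=; rewrite !inE.
by apply/negP => /andP[/bA kb /adjE].
Qed.

Lemma infinite_natP (S : set nat) :
  infinite_set S <-> forall N, exists2 n, (N <= n)%N & S n.
Proof.
split=> [iS N|SN /finite_seqP[s Ss]].
  apply: contrapT => SN; apply: iS; apply: sub_finite_set (finite_II N) => n Sn /=.
  by rewrite ltnNge; apply/negP => Nn; apply: SN; exists n.
have [n] := SN (\max_(i <- s) i).+1; rewrite Ss /= => + ns.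
by rewrite ltnNge (@leq_bigmax_seq _ _ xpredT id).
Qed.

(** * Almost sure behaviour of the process *)

Section Process.
Context {R : realType} {disp : measure_display} {Omega : measurableType disp}.
Context {P : probability Omega R} {d : nat -> nat}.
Context {A : forall i : nat, Omega -> {set 'I_i}}.
Hypothesis dn : forall n, (d n <= n)%N.
Hypothesis procA : graph_process P d A.

Let a_ n : R := min_ratio R d n.
Let a_ge0 n : 0 <= a_ n. Proof. exact: min_ratio_ge0. Qed.

Let sumX_nd k : nondecreasing_seq (fun N => \sum_(1 <= n < N) a_ n ^+ k).
Proof.
by apply: nondecreasing_series => n _ _; rewrite exprn_ge0.
Qed.

Lemma witness_prob (a b : seq nat) n :
  uniq a -> uniq b -> ~~ has (mem a) b ->
  all (fun i => (i < n)%N) a -> all (fun i => (i < n)%N) b ->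
  P [set w | A n w \in witness a b n] =
  (sep_prob (size a) (size b) n (d n))%:E.
Proof.
move=> ua ub ab an bn; rewrite (choice_law procA) /sep_prob; congr _%:E.
have EF : [disjoint [set k : 'I_n | val k \in a]%SET &
                      [set k : 'I_n | val k \in b]%SET]%bool.
  apply/pred0P => k /=; rewrite !inE; apply/negP => /andP[ka kb].
  by move/hasPn: ab => /(_ _ kb) /=; rewrite ka.
have := card_separating (k := d n) EF; rewrite card_ord => /(_ (dn n)).
rewrite !card_ord_mem // => /(congr1 (fun m => m%:R : R)); rewrite !natrM => E.
have C0 : 'C(n, d n)%:R != 0 :> R by rewrite pnatr_eq0 -lt0n bin_gt0.
apply/eqP; rewrite eqr_div //; first by rewrite /witness E mulrC.
rewrite pnatr_eq0 -lt0n ffact_gt0.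
rewrite -[X in (X + _)%N](card_ord_mem ua an).
rewrite -[X in (_ + X)%N](card_ord_mem ub bn).
rewrite -[X in (_ <= X)%N](card_ord n) -cardsUI (disjoint_setI0 EF).
by rewrite cards0 addn0 max_card.
Qed.

Lemma ae_witness (a b : seq nat) N0 :
  (forall k, (0 < k)%N -> ~ cvgn (fun N => \sum_(1 <= n < N) a_ n ^+ k)) ->
  uniq a -> uniq b -> ~~ has (mem a) b ->
  {ae P, forall w, exists2 n, (N0 <= n)%N &
    (forall x, x \in a -> generated_adj A w n x) /\
    (forall x, x \in b -> ~ generated_adj A w n x)}.
Proof.
move=> div ua ub ab.
(* Only from N1 on are all of a and b among the earlier vertices. *)
pose N1 := maxn N0 (\max_(i <- a ++ b) i).+1.
have N01 : (N0 <= N1)%N by exact: leq_maxl.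
have N1_gt0 : (0 < N1)%N by rewrite leq_max orbT.
have ltN1 n : (N1 <= n)%N -> all (fun i => (i < n)%N) (a ++ b).
  move=> N1n; apply/allP => i iab; apply: leq_trans N1n.
  rewrite leq_max; apply/orP; right.
  by rewrite ltnS (@leq_bigmax_seq _ _ xpredT id).
have : {ae P, forall w, exists2 n, (N1 <= n)%N & A n w \in witness a b n}.
  pose p n : R := sep_prob (size a) (size b) n (d n).
  apply: (choice_BorelCantelli procA (p := p)).
    by move=> n /ltN1; rewrite all_cat => /andP[an bn]; exact: witness_prob.
  (* A partial sum of the a_n^(s + t + 2) exceeding the terms before N1, the
     contribution 2 C of the exceptional rounds and 2^(s + t) |M| provides a
     partial sum of the probabilities above M. *)
  move=> M; set st := (size a + size b)%N.
  pose u N := \sum_(1 <= n < N) a_ n ^+ st.+2.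
  pose C : R := st.*2%:R ^+ st.+2.
  have C0 : 0 <= C by exact: exprn_ge0.
  have u_unbounded : ~ has_ubound (range u).
    by move=> /(nondecreasing_is_cvgn (sumX_nd st.+2)); exact: div.
  have /has_ubPn/(_ (u N1 + 2 ^+ st * `|M| + C * 2)) := u_unbounded.
  move=> [_ [N _ <-] uN].
  have NN1 : (N1 <= N)%N.
    rewrite leqNgt; apply/negP => /ltnW /(sumX_nd st.+2); apply/negP.
    rewrite -ltNge; apply: le_lt_trans uN.
    by rewrite -addrA lerDl addr_ge0 // mulr_ge0 // exprn_ge0.
  exists N.
  have uE : u N = u N1 + \sum_(N1 <= n < N) a_ n ^+ st.+2.
    by rewrite /u (big_cat_nat N1_gt0 NN1).
  have : \sum_(N1 <= n < N) a_ n ^+ st.+2 <=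
         2 ^+ st * (\sum_(N1 <= n < N) p n) + C * 2.
    apply: (@le_trans _ _ (2 ^+ st * (\sum_(N1 <= n < N) p n) +
                           C * \sum_(N1 <= n < N) (n%:R ^+ 2)^-1)).
      rewrite !mulr_sumr -big_split /= !big_nat; apply: ler_sum => n /andP[N1n _].
      by apply: min_ratio_le => //; exact: leq_trans N1n.
    rewrite lerD2l ler_wpM2l // (le_trans _ (sum_invr_sqr_le R N)) //.
    by rewrite [leRHS](big_cat_nat N1_gt0 NN1) //= lerDr sumr_ge0 // => n _;
       rewrite invr_ge0 exprn_ge0.
  have two_gt0 : 0 < 2 ^+ st :> R by rewrite exprn_gt0.
  move=> le_sum; apply: le_trans (ler_norm M) _; rewrite -(ler_pM2l two_gt0).
  by move: uN; rewrite uE; lra.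
apply: filterS => w [n N1n wit]; exists n; first exact: leq_trans N1n.
move: (ltN1 n N1n); rewrite all_cat => /andP[an bn].
by apply/(witness_adj A w an bn).
Qed.

Lemma ae_rado :
  (forall k, (0 < k)%N -> ~ cvgn (fun N => \sum_(1 <= n < N) a_ n ^+ k)) ->
  {ae P, forall w, is_rado (generated A w)}.
Proof.
move=> div.
(* The almost sure events are indexed by the codes of the triples (a, b, N0), as
   only countably many of them can be intersected. *)
pose Q (m : nat) w := if unpickle m is Some (a, b, N0) then
  uniq a -> uniq b -> ~~ has (mem a) b -> exists2 n, (N0 <= n)%N &
    (forall x, x \in a -> generated_adj A w n x) /\
    (forall x, x \in b -> ~ generated_adj A w n x) else True.
have : {ae P, forall w, forall m, Q m w}.
  apply: ae_foralln => m; rewrite /Q.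
  case: (unpickle m) => [[[a b] N0]|]; last exact: aeW.
  have [ab|ab] := boolP [&& uniq a, uniq b & ~~ has (mem a) b]; last first.
    by apply: aeW => w ua ub nab; move: ab; rewrite ua ub nab.
  case/and3P: ab => ua ub nab.
  by apply: filterS (ae_witness N0 div ua ub nab) => w.
apply: filterS => w wQ; split; first exact: card_eqxx.
move=> _ _ /finite_seqP[a ->] /finite_seqP[b ->] ab0; apply/infinite_natP => N0.
have := wQ (pickle (undup a, undup b, N0)); rewrite /Q pickleK !undup_uniq.
case=> //.
  apply/hasPn => x; rewrite mem_undup => xb; apply/negP; rewrite inE mem_undup => xa.
  by have : ([set` a] `&` [set` b]) x by []; rewrite ab0.
move=> n N0n [na nb]; exists n => //; split => x /= xX.
  by apply: na; rewrite mem_undup.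
by apply: nb; rewrite mem_undup.
Qed.

Lemma ae_not_rado k : (0 < k)%N ->
  cvgn (fun N => \sum_(1 <= n < N) a_ n ^+ k) ->
  {ae P, forall w, ~ is_rado (generated A w)}.
Proof.
move=> k0 cva.
pose a := iota 0 k; pose b := iota k k.
have an n : (k.*2.*2 <= n)%N -> all (fun i => (i < n)%N) a.
  by move=> kn; apply/allP => i; rewrite mem_iota; lia.
have bn n : (k.*2.*2 <= n)%N -> all (fun i => (i < n)%N) b.
  by move=> kn; apply/allP => i; rewrite mem_iota; lia.
have nab : ~~ has (mem a) b.
  by apply/hasPn => i; rewrite inE !mem_iota; lia.
(* Below 4 k the bound on the probabilities is not available; these rounds are
   left out of the events, which does not affect their limit superior. *)
pose F n := [set w | (k.*2.*2 <= n)%N /\ A n w \in witness a b n].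
have FE n : (k.*2.*2 <= n)%N -> F n = [set w | A n w \in witness a b n].
  by move=> kn; apply/seteqP; split => w; rewrite /F /=; [case | split].
have F0 n : (n < k.*2.*2)%N -> F n = set0.
  by move=> kn; rewrite -subset0 => w []; rewrite leqNgt kn.
have mF n : measurable (F n).
  have [/F0 ->|/FE ->] := ltnP n k.*2.*2; first exact: measurable0.
  exact: (choice_measurable procA).
have PF n : (0 < n)%N -> (P (F n) <= (4 ^+ k * a_ n ^+ k)%:E)%E.
  move=> n0; have [/F0 ->|kn] := ltnP n k.*2.*2.
    by rewrite measure0 lee_fin mulr_ge0 // exprn_ge0.
  rewrite FE // witness_prob ?iota_uniq ?an ?bn // !size_iota lee_fin.
  exact: sep_prob_le.
exists (lim_sup_set F); split.
- by apply: bigcap_measurable => // n _; apply: bigcup_measurable => j _.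
- apply: lim_sup_set_cvg0 => //.
  have [l l_ge] : exists l, forall N, \sum_(1 <= n < N) a_ n ^+ k <= l.
    exists (limn (fun N => \sum_(1 <= n < N) a_ n ^+ k)).
    exact: nondecreasing_cvgn_le.
  have l_ge0 : 0 <= l by have := l_ge 0%N; rewrite big_geq.
  apply: (@le_lt_trans _ _ (4 ^+ k * l)%:E); last exact: ltry.
  apply: lime_le; first by apply: is_cvg_nneseries => n _ _; exact: measure_ge0.
  apply: nearW => N.
  case: N => [|N]; first by rewrite big_geq // lee_fin mulr_ge0 // exprn_ge0.
  rewrite big_ltn // F0; last by lia.
  rewrite measure0 add0e.
  apply: (@le_trans _ _ (\sum_(1 <= n < N.+1) (4 ^+ k * a_ n ^+ k)%:E)%E).
    by rewrite !big_nat; apply: lee_sum => n /andP[n0 _]; exact: PF.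
  by rewrite sumEFin lee_fin -mulr_sumr ler_wpM2l ?exprn_ge0.
- move=> w radow' m _; have [_ radow] := contrapT radow'.
  have ab0 : [set` a] `&` [set` b] = set0.
    rewrite -subset0 => i [/= ia ib].
    by move/hasPn: nab => /(_ i ib); rewrite inE ia.
  have /infinite_natP inf := radow _ _ (finite_seq a) (finite_seq b) ab0.
  have [n] := inf (maxn m k.*2.*2).
  rewrite geq_max => /andP[mn kn] nw; exists n => //; split => //.
  by apply/(witness_adj A w (an _ kn) (bn _ kn)).
Qed.

End Process.

Theorem corollary2p4 (R : realType) (disp : measure_display)
    (Omega : measurableType disp) (P : probability Omega R)
    (d : nat -> nat) (A : forall i : nat, Omega -> {set 'I_i})
    (V : Type) (Rado : graph V) :
  (forall n, (d n <= n)%N) ->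
  graph_process P d A ->
  is_rado Rado ->
  ((forall k : nat, (0 < k)%N ->
      ~ cvgn (fun N => \sum_(1 <= n < N) min_ratio R d n ^+ k)) ->
    {ae P, forall w, isomorphic (generated A w) Rado}) /\
  ((exists2 k : nat, (0 < k)%N &
      cvgn (fun N => \sum_(1 <= n < N) min_ratio R d n ^+ k)) ->
    {ae P, forall w, ~ isomorphic (generated A w) Rado}).
Proof.
move=> dn procA radoR; split.
  by move=> /(ae_rado dn procA); apply: filterS => w radow; exact: rado_unique.
move=> [k k0 /(ae_not_rado dn procA k0)]; apply: filterS => w nradow iso.
by apply: nradow; exact: rado_iso iso radoR.
Qed.
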